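(* Let $Z,Y$ be two real Hilbert spaces. Suppose that $X\subset Z$ and let $v\colon X\to Y$ be a map. Consider the following conditions. (i) For all finite $m\leq \dim Y$, all $x,x_1,\dotsc,x_m\in X$ and all non-negative real numbers $t_1,\dotsc,t_m$ that sum up to one, $$\Big\lVert v(x)-\sum_{i=1}^m t_i v(x_i)\Big\rVert\leq \Big\lVert x-\sum_{i=1}^m t_i x_i\Big\rVert .$$ (ii) For any closed, convex set $K\subset Y$, for any $A\subset X$, and for any $1$-Lipschitz map $u\colon A\to Y$ such that $u(x)-v(x)\in K$ for all $x\in A$, there exists a $1$-Lipschitz extension $\tilde u\colon X\to Y$ of $u$ such that $\tilde u(x)-v(x)\in K$ for all $x\in X$. (iii) For any $A\subset X$, any $\delta\geq 0$, and for any $1$-Lipschitz map $u\colon A\to Y$ such that $\lVert u(x)-v(x)\rVert\leq\delta$ for all $x\in A$, there exists a $1$-Lipschitz extension $\tilde u\colon X\to Y$ of $u$ such that $\lVert \tilde u(x)-v(x)\rVert\leq \delta$ for all $x\in X$. Then each of these conditions implies the subsequent one: (i) implies (ii), and (ii) implies (iii). Moreover, if either $\dim Y\in\{1,2,3\}$ or $X$ is convex, then (iii) implies (i), so that (i), (ii), (iii) are equivalent.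
   Context: A map $u\colon A\to Y$, with $A$ a subset of a Hilbert space, is $1$-Lipschitz if $\lVert u(x)-u(y)\rVert\leq\lVert x-y\rVert$ for all $x,y\in A$. An extension of $u\colon A\to Y$ to $X\supset A$ is a map $\tilde u\colon X\to Y$ with $\tilde u|_A=u$. The Hilbert spaces may be infinite-dimensional; ''finite $m\leq \dim Y$'' means any positive integer $m$ with $m\leq\dim Y$ (any positive integer if $\dim Y=\infty$).
   Formalization: In condition (ii) the closed convex set K is required to be nonempty; with K and A both empty and X nonempty, no extension can exist, so (i) would not imply (ii) as literally stated (e.g. v = 0). *)

(* Defs.v *)
From HB Require Import structures.
From mathcomp Require Import all_boot all_order all_algebra.
From mathcomp Require Import all_classical all_reals all_analysis.

Set Implicit Arguments.
Unset Strict Implicit.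
Unset Printing Implicit Defensive.

Import Order.TTheory GRing.Theory Num.Theory.
Import numFieldNormedType.Exports.

Local Open Scope classical_set_scope.
Local Open Scope ring_scope.

HB.mixin Record CompleteNormedModule_isHilbert (R : realType) V
    of CompleteNormedModule R V := {
  inner : V -> V -> R;
  innerC : forall x y, inner x y = inner y x;
  innerDl : forall x y z, inner (x + y) z = inner x z + inner y z;
  innerZl : forall (a : R) x y, inner (a *: x) y = a * inner x y;
  inner_normE : forall x, inner x x = `|x| ^+ 2
}.

#[short(type="hilbertType")]
HB.structure Definition Hilbert (R : realType) :=
  { V of CompleteNormedModule R V & CompleteNormedModule_isHilbert R V }.

Section Dimension.
Variables (R : realType) (V : lmodType R).

Definition is_basis (n : nat) (e : 'I_n -> V) : Prop :=
  (forall c : 'I_n -> R, \sum_(i < n) c i *: e i = 0 -> forall i, c i = 0) /\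
  (forall x, exists c : 'I_n -> R, x = \sum_(i < n) c i *: e i).

Definition has_dim (n : nat) : Prop := exists e : 'I_n -> V, is_basis e.

(* [m <= dim V]; every [m] qualifies when [V] has no finite basis. *)
Definition le_dim (m : nat) : Prop := forall n, has_dim n -> (m <= n)%N.

End Dimension.

(* Maps defined on a subset of [Z] are represented by total functions [Z -> Y]
   of which only the values on that subset matter. *)
Section Conditions.
Variables (R : realType) (Z Y : hilbertType R) (X : set Z) (v : Z -> Y).

Definition convex_comb_contraction : Prop :=
  forall m : nat, (0 < m)%N -> le_dim Y m ->
  forall (x : Z) (xs : 'I_m -> Z) (t : 'I_m -> R),
    X x -> (forall i, X (xs i)) ->
    (forall i, 0 <= t i) -> \sum_(i < m) t i = 1 ->
  `|v x - \sum_(i < m) t i *: v (xs i)| <= `|x - \sum_(i < m) t i *: xs i|.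

Definition is_lip1_extension (A : set Z) (u ut : Z -> Y) : Prop :=
  1.-lipschitz_X ut /\ (forall x, A x -> ut x = u x).

(* [K] has to be nonempty: for [A = K = set0] the hypothesis on [u] holds
   vacuously, whereas no extension to a nonempty [X] can satisfy the
   conclusion. *)
Definition convex_extension : Prop :=
  forall K : set Y, K !=set0 -> closed K -> convex_set K ->
  forall A : set Z, A `<=` X ->
  forall u : Z -> Y, 1.-lipschitz_A u -> (forall x, A x -> K (u x - v x)) ->
  exists ut : Z -> Y,
    is_lip1_extension A u ut /\ (forall x, X x -> K (ut x - v x)).

Definition ball_extension : Prop :=
  forall A : set Z, A `<=` X -> forall delta : R, 0 <= delta ->
  forall u : Z -> Y, 1.-lipschitz_A u ->
    (forall x, A x -> `|u x - v x| <= delta) ->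
  exists ut : Z -> Y,
    is_lip1_extension A u ut /\ (forall x, X x -> `|ut x - v x| <= delta).

End Conditions.

(* Main.v *)
Require Import Defs.
From HB Require Import structures.
From mathcomp Require Import all_boot all_order all_algebra.
From mathcomp Require Import all_classical all_reals all_analysis.
From mathcomp Require Import ring lra.

Set Implicit Arguments.
Unset Strict Implicit.
Unset Printing Implicit Defensive.

Import Order.TTheory GRing.Theory Num.Theory.
Import numFieldNormedType.Exports.

Local Open Scope classical_set_scope.
Local Open Scope ring_scope.

(** Extending a 1-Lipschitz map [u] to one further point [x] with value in
    [v x + K] means finding a common point of [v x + K] and of the balls about
    the [u a] with radii [`|a - x|].  Closed convex sets of a Hilbert space, one
    of them bounded, have a common point as soon as finitely many of them always
    do ([bounded_closed_convex_fip]), and Zorn's lemma iterates the extension,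
    so the first implication is a statement about finitely many balls
    ([finite_common_point]).

    For finitely many balls, minimax duality gives weights [t] and a point [p]
    of [v x + K], the projection of the barycentre of the [u a], at which the
    ball constraints with positive weight are the worst ones
    ([exists_saddle_point]).  The vector from [p] to the barycentre is normal to
    [v x + K] at [p], and Carathéodory's theorem for cones rewrites it with at
    most [dim Y] points, which is where the bound [m <= dim Y] in (i) comes
    from.  The set [v x + K] contains the barycentre of the [u a]
    shifted by [v x - \sum_a t_a v a]; normality bounds the distance from [p] to
    the barycentre by the length of this shift, hence, by (i), by
    [`|x - \sum_a t_a a|].  A Lipschitz map does not increase the weighted
    variance ([lip_barycentre]), so the weighted squared distances from [p] to
    the [u a] cannot exceed those from [x] to the [a], as they would if a
    constraint failed.

    The second implication takes for [K] a ball about the origin.  Conversely,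
    let [e] be the direction of [\sum_i t_i v x_i - v x].  Balls of large radius
    imitate the half-space [{k | inner k e <= 0}], so (iii) also yields
    extensions subject to that half-space constraint.  Suppose that points [u i]
    of [Y] have the same [e]-components as the [v x_i] and the same mutual
    distances as the [x_i].  The value at [x] of an extension of [x_i |-> u i]
    then lies at distance at most [`|x - \sum_i t_i x_i|] from the barycentre,
    by [lip_barycentre] with the roles exchanged, while its [e]-component is
    smaller than that of the barycentre by at least the length of
    [\sum_i t_i v x_i - v x]: this is (i) ([component_bound]).

    Such points exist if [`|x_i - x_j| ^+ 2 - inner (v x_i - v x_j) e ^+ 2] are
    the squared distances of points orthogonal to [e].  For two points this only
    requires a second dimension and that [v] is 1-Lipschitz.  For three points
    in a space of dimension three it is the positivity of a binary form, whose
    coefficient vectors have, up to sign, a single negative entry, so that the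
    case of two points gives it.  If [X] is convex, the case of two points
    already forces [v] to be affine on [X], and (i) follows from the Lipschitz
    property. *)

(** * Inner product identities *)

Section InnerProduct.
Context {R : realType} {V : hilbertType R}.
Implicit Types (x y z : V) (a : R).

Lemma innerDr x y z : inner x (y + z) = inner x y + inner x z.
Proof. by rewrite innerC innerDl !(innerC _ x). Qed.

Lemma innerZr a x y : inner x (a *: y) = a * inner x y.
Proof. by rewrite innerC innerZl innerC. Qed.

Lemma innerNl x y : inner (- x) y = - inner x y.
Proof. by rewrite -scaleN1r innerZl mulN1r. Qed.

Lemma innerNr x y : inner x (- y) = - inner x y.
Proof. by rewrite -scaleN1r innerZr mulN1r. Qed.

Lemma inner0l x : inner 0 x = 0.
Proof. by rewrite -(scale0r 0) innerZl mul0r. Qed.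

Lemma inner0r x : inner x 0 = 0.
Proof. by rewrite innerC inner0l. Qed.

Definition innerE := (@innerDl R V, innerDr, @innerZl R V, innerZr,
  innerNl, innerNr, inner0l, inner0r).

Lemma inner_suml (I : finType) (f : I -> V) y :
  inner (\sum_i f i) y = \sum_i inner (f i) y.
Proof.
elim/big_rec2: _ => [|i u w _ <-]; first exact: inner0l.
by rewrite innerDl.
Qed.

Lemma cauchy_schwarz x y : inner x y <= `|x| * `|y|.
Proof.
have [->|x0] := eqVneq x 0; first by rewrite inner0l normr0 mul0r.
have [->|y0] := eqVneq y 0; first by rewrite inner0r normr0 mulr0.
have xy_gt0 : 0 < `|x| * `|y| by rewrite mulr_gt0 ?normr_gt0.
have : 0 <= inner (`|y| *: x - `|x| *: y) (`|y| *: x - `|x| *: y).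
  by rewrite inner_normE sqr_ge0.
rewrite !innerE !inner_normE (innerC y x) => h.
rewrite -subr_ge0 -(pmulr_rge0 _ xy_gt0); nra.
Qed.

Lemma sqr_normD x y : `|x + y| ^+ 2 = `|x| ^+ 2 + 2 * inner x y + `|y| ^+ 2.
Proof. by rewrite -!inner_normE !innerE (innerC y x); ring. Qed.

Lemma sqr_normB x y : `|x - y| ^+ 2 = `|x| ^+ 2 - 2 * inner x y + `|y| ^+ 2.
Proof. by rewrite -!inner_normE !innerE (innerC y x); ring. Qed.

Lemma sqr_dist_midpoint x y :
  `|x - y| ^+ 2 = 2 * `|x| ^+ 2 + 2 * `|y| ^+ 2
                  - 4 * `|2^-1 *: x + (1 - 2^-1) *: y| ^+ 2.
Proof. by rewrite -!inner_normE !innerE (innerC y x); field. Qed.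

End InnerProduct.

(** * Barycentres *)

Section Barycentre.
Context {R : realType} {V : hilbertType R} {I : finType}.
Implicit Types (t : I -> R) (z : I -> V).

(** Steiner's parallel axis identity. *)
Lemma weighted_variance t z y : \sum_i t i = 1 ->
  \sum_i t i * `|z i - y| ^+ 2 =
  `|\sum_i t i *: z i - y| ^+ 2 +
  \sum_i t i * `|z i - \sum_j t j *: z j| ^+ 2.
Proof.
move=> t1; set w := \sum_i t i *: z i.
have E i : t i * `|z i - y| ^+ 2 =
    t i * `|z i - w| ^+ 2 + (2 * inner (t i *: z i - t i *: w) (w - y)
      + t i * `|w - y| ^+ 2).
  have -> : z i - y = (z i - w) + (w - y) by rewrite addrA subrK.
  by rewrite sqr_normD -scalerBr innerZl; ring.
rewrite (eq_bigr _ (fun i _ => E i)) !big_split /= -!mulr_sumr -mulr_suml t1.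
rewrite -inner_suml big_split /= -/w sumrN -scaler_suml t1 scale1r subrr.
by rewrite inner0l; ring.
Qed.

Lemma double_variance t z : \sum_i t i = 1 ->
  \sum_i \sum_j t i * t j * `|z i - z j| ^+ 2 =
  2 * \sum_i t i * `|z i - \sum_j t j *: z j| ^+ 2.
Proof.
move=> t1; set w := \sum_i t i *: z i; rewrite exchange_big /=.
under eq_bigr => j _.
  under eq_bigr => i _ do rewrite [t i * t j]mulrC -mulrA.
  rewrite -mulr_sumr (weighted_variance _ _ t1) mulrDr -/w distrC.
  over.
by rewrite big_split /= -mulr_suml t1; ring.
Qed.

End Barycentre.

(** A 1-Lipschitz correspondence does not increase the variance of a weighted
    system of points; the excess of the weighted squared distances from a pair
    of poles is therefore controlled by the barycentres alone.  It serves in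
    both directions: to solve distance constraints, and, read for isometric
    systems with the roles exchanged, to show that they force the barycentres
    apart. *)
Lemma lip_barycentre (R : realType) (Z Y : hilbertType R) (I : finType)
    (t : I -> R) (z : I -> Z) (u : I -> Y) (x : Z) (y : Y) :
  (forall i, 0 <= t i) -> \sum_i t i = 1 ->
  (forall i j, `|u i - u j| <= `|z i - z j|) ->
  \sum_i t i * (`|u i - y| ^+ 2 - `|z i - x| ^+ 2) <=
  `|\sum_i t i *: u i - y| ^+ 2 - `|\sum_i t i *: z i - x| ^+ 2.
Proof.
move=> t0 t1 uz.
have hz := double_variance z t1; have hu := double_variance u t1.
have : \sum_i \sum_j t i * t j * `|u i - u j| ^+ 2 <=
       \sum_i \sum_j t i * t j * `|z i - z j| ^+ 2.
  apply: ler_sum => i _; apply: ler_sum => j _.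
  by rewrite ler_wpM2l ?mulr_ge0// lerXn2r ?nnegrE.
rewrite {}hu {}hz => h.
under eq_bigr => i _ do rewrite mulrBr.
rewrite sumrB (weighted_variance u y t1) (weighted_variance z x t1).
lra.
Qed.

(** * Closed convex sets *)

Lemma le0_of_le_small (R : realType) (a b : R) :
  (forall s : R, 0 < s -> s < 1 -> a <= s * b) -> a <= 0.
Proof.
move=> h; rewrite leNgt; apply/negP => a0.
have b0 : 0 < `|b| + a by rewrite ltr_wpDl.
have m0 : 0 < `|b| *+ 2 + a *+ 2 by rewrite -mulrnDl pmulrn_lgt0.
have s0 : 0 < a / (`|b| *+ 2 + a *+ 2) by rewrite divr_gt0.
have s1 : a / (`|b| *+ 2 + a *+ 2) < 1.
  by rewrite ltr_pdivrMr// mul1r; have := normr_ge0 b; lra.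
have := h _ s0 s1; rewrite mulrAC ler_pdivlMr//.
rewrite ler_pM2l//; have := ler_norm b; lra.
Qed.

Lemma convex_setP (R : realType) (V : lmodType R) (C : set V) : convex_set C <->
  forall x y (s : R), 0 <= s <= 1 -> C x -> C y -> C (s *: x + (1 - s) *: y).
Proof.
split=> [cC x y s s01 Cx Cy|cC x y l /set_mem Cx /set_mem Cy].
  have := cC x y (Itv01 (proj1 (andP s01)) (proj2 (andP s01))) (mem_set Cx) (mem_set Cy).
  by move/set_mem.
by apply/mem_set/cC => //; apply/andP; split.
Qed.

Lemma convex_sum (R : realType) (V : lmodType R) (C : set V) n
    (t : 'I_n -> R) (z : 'I_n -> V) : convex_set C ->
  (forall i, 0 <= t i) -> \sum_i t i = 1 -> (forall i, C (z i)) ->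
  C (\sum_i t i *: z i).
Proof.
move=> /convex_setP cC; elim: n t z => [|n IH] t z t0 t1 Cz.
  by move: t1; rewrite big_ord0 => /esym/eqP; rewrite oner_eq0.
pose b := \sum_(i < n) t (lift ord0 i).
have tb : t ord0 = 1 - b by rewrite -t1 big_ord_recl addrK.
have b0 : 0 <= b by apply: sumr_ge0.
rewrite big_ord_recl; have [b_eq0|bn0] := eqVneq b 0.
  rewrite tb b_eq0 subr0 scale1r big1 ?addr0// => i _.
  have /eqP := b_eq0; rewrite psumr_eq0// => /allP/(_ i (mem_index_enum _)).
  by move=> /= /eqP ->; rewrite scale0r.
have -> : \sum_(i < n) t (lift ord0 i) *: z (lift ord0 i) =
    (1 - t ord0) *: \sum_(i < n) (t (lift ord0 i) / b) *: z (lift ord0 i).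
  rewrite tb subKr scaler_sumr; apply: eq_bigr => i _.
  by rewrite scalerA mulrC divfK.
apply: cC => //; first by rewrite t0 tb gerBl.
apply: IH => // [i|]; first by rewrite divr_ge0.
by rewrite -mulr_suml divff.
Qed.

Section ConvexSets.
Context {R : realType} {V : hilbertType R}.
Implicit Types (A C : set V).

Lemma convex_setI A C : convex_set A -> convex_set C -> convex_set (A `&` C).
Proof.
move=> /convex_setP cA /convex_setP cC; apply/convex_setP.
by move=> x y s s01 [Ax Cx] [Ay Cy]; split; [exact: cA|exact: cC].
Qed.

Lemma convex_translate C x : convex_set C -> convex_set [set y : V | C (y - x)].
Proof.
move=> /convex_setP cC; apply/convex_setP => y z s s01 Cy Cz /=.
rewrite [X in C X](_ : _ = s *: (y - x) + (1 - s) *: (z - x)); first exact: cC.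
rewrite !scalerBr addrACA; congr (_ + _).
by rewrite -opprD -scalerDl addrC subrK scale1r.
Qed.

Lemma convex_norm_ball x (r : R) : convex_set [set y : V | `|y - x| <= r].
Proof.
apply/convex_setP => y z s /andP[s0 s1] /= yr zr.
have -> : s *: y + (1 - s) *: z - x = s *: (y - x) + (1 - s) *: (z - x).
  rewrite !scalerBr addrACA; congr (_ + _).
  by rewrite -opprD -scalerDl addrC subrK scale1r.
apply: le_trans (ler_normD _ _) _.
rewrite !normrZ (ger0_norm s0) ger0_norm ?subr_ge0//.
have s1' : 0 <= 1 - s by rewrite subr_ge0.
by have := ler_wpM2l s0 yr; have := ler_wpM2l s1' zr; lra.
Qed.

Lemma closed_translate C x : closed C -> closed [set y | C (y - x)].
Proof.
move=> clC; apply: (@preimage_closed _ _ (fun y => y - x)) => // y _.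
by apply: continuousB; [exact: cvg_id|exact: cvg_cst].
Qed.

Lemma closed_norm_ball x (r : R) : closed [set y : V | `|y - x| <= r].
Proof.
apply: (@preimage_closed _ _ (fun y => `|y - x|) [set a | a <= r]); last first.
  exact: closed_le.
move=> y _; apply: (@continuous_comp _ _ _ (fun y => y - x) Num.norm).
  by apply: continuousB; [exact: cvg_id|exact: cvg_cst].
exact: norm_continuous.
Qed.

(** Weak compactness without the weak topology.  The least norm over a finite
    subfamily is bounded along the subfamilies; where it is almost maximal, the
    parallelogram identity makes all points of almost least norm close to each
    other.  These points form a Cauchy filter, and its limit lies in every
    member of the family. *)
Lemma bounded_closed_convex_fip (T : eqType) (G : set T) (C : T -> set V)
    (i0 : T) (M : R) :
  (forall i, G i -> closed (C i)) -> (forall i, G i -> convex_set (C i)) ->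
  G i0 -> (forall y, C i0 y -> `|y| <= M) ->
  (forall s : seq T, (forall i, i \in s -> G i) ->
     exists y, forall i, i \in s -> C i y) ->
  exists y, forall i, G i -> C i y.
Proof.
move=> clC cvC Gi0 bndC fip.
pose D (s : seq T) := [set y | C i0 y /\ forall i, i \in s -> C i y].
pose G' (s : seq T) := forall i, i \in s -> G i.
pose N s := [set `|y| ^+ 2 | y in D s].
have D0 s : G' s -> D s !=set0.
  move=> Gs; have [|y yP] := fip (i0 :: s).
    by move=> i; rewrite inE => /orP[/eqP->|/Gs].
  exists y; split; first by apply: yP; rewrite mem_head.
  by move=> i si; apply: yP; rewrite inE si orbT.
have Dle s y : D s y -> `|y| ^+ 2 <= M ^+ 2.
  move=> [/bndC yM _]; rewrite lerXn2r ?nnegrE//.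
  by apply: le_trans yM.
have lbN s : has_lbound (N s).
  by exists 0 => _ [y _ <-]; rewrite sqr_ge0.
have hiN s : G' s -> has_inf (N s).
  by move=> /D0[y Dy]; split; [exists (`|y| ^+ 2); exists y|exact: lbN].
have infle s y : D s y -> inf (N s) <= `|y| ^+ 2.
  by move=> Dy; apply: ge_inf => //; exists y.
pose E := [set inf (N s) | s in G'].
have supE : has_sup E.
  split; first by exists (inf (N [::])); exists [::].
  exists (M ^+ 2) => _ [s Gs <-]; have [y Dy] := D0 _ Gs.
  exact: le_trans (infle _ _ Dy) (Dle _ _ Dy).
pose d := sup E.
have infd s : G' s -> inf (N s) <= d.
  by move=> Gs; apply: ub_le_sup; [exact: supE.2|exists s].
pose J := [set p : seq T * R | G' p.1 /\ 0 < p.2].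
pose B (p : seq T * R) := [set y | D p.1 y /\ `|y| ^+ 2 <= d + p.2].
have FF : Filter (filter_from J B).
  apply: filter_from_filter; first by exists ([::], 1); split => //=.
  move=> [s e] [s' e'] [/= Gs e0] [/= Gs' e'0].
  exists (s ++ s', Num.min e e').
    split => /=; last by rewrite lt_min e0.
    by move=> i; rewrite mem_cat => /orP[/Gs|/Gs'].
  move=> y [/= [Ciy Dy] ye]; split; split => /=.
  - by split => // i si; apply: Dy; rewrite mem_cat si.
  - by apply: le_trans ye _; rewrite lerD2l ge_min lexx.
  - by split => // i si; apply: Dy; rewrite mem_cat si orbT.
  - by apply: le_trans ye _; rewrite lerD2l ge_min lexx orbT.
have B0 p : J p -> B p !=set0.
  case: p => s e [/= Gs e0].
  have [_ [y Dy <-] ylt] := inf_adherent e0 (hiN _ Gs).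
  exists y; split => //=; apply: ltW; apply: lt_le_trans ylt _.
  by rewrite lerD2r infd.
have PF : ProperFilter (filter_from J B) by apply: filter_from_proper.
have : cauchy (filter_from J B).
  apply: cauchy_exP => e e0.
  have eta0 : 0 < e ^+ 2 / 16 by rewrite divr_gt0 ?exprn_gt0.
  have [_ [s Gs <-] slt] := sup_adherent eta0 supE.
  have Js : J (s, e ^+ 2 / 16) by [].
  have [x [Dx xle]] := B0 _ Js.
  exists x; exists (s, e ^+ 2 / 16) => // y [Dy yle].
  rewrite -ball_normE /ball_ /=.
  have half : 0 <= (2^-1 : R) <= 1 by lra.
  have Dm : D s (2^-1 *: x + (1 - 2^-1) *: y).
    case: Dx Dy => /= Cx Dx [/= Cy Dy]; split.
      by have /convex_setP := cvC _ Gi0; apply.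
    by move=> i si; have /convex_setP := cvC _ (Gs _ si); apply=> //; auto.
  rewrite -(@ltr_pXn2r _ 2)// ?nnegrE ?(ltW e0)// sqr_dist_midpoint.
  have := infle _ _ Dm; rewrite /= in xle yle slt.
  have e2 : 0 < e ^+ 2 by rewrite exprn_gt0.
  by rewrite /d in xle yle *; lra.
move=> /cauchy_cvg /cvg_ex[l Fl].
exists l => i Gi; apply: (@closed_cvg _ _ _ PF id (C i)) Fl; first exact: clC.
exists ([:: i], 1) => /=.
  by split => //= j; rewrite inE => /eqP ->.
by move=> y [[_ +] _]; apply; rewrite mem_head.
Qed.

(** The nearest point of [C] to [w], characterized by the obtuse angle that it
    forms with any other point of [C]. *)
Lemma exists_projection C (w : V) : closed C -> convex_set C -> C !=set0 ->
  exists p, C p /\ forall c, C c -> inner (w - p) (c - p) <= 0.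
Proof.
move=> clC cvC [c0 Cc0].
pose N := [set `|c - w| | c in C].
have lbN : has_lbound N by exists 0 => _ [y _ <-].
have iN : has_inf N by split => //; exists `|c0 - w|; exists c0.
pose B (e : R) := C `&` [set y : V | `|y - w| <= inf N + e].
have [||||s s0|p Bp] := @bounded_closed_convex_fip R [set e | 0 < e] B 1
    (inf N + 1 + `|w|).
- by move=> e _; apply: closedI => //; exact: closed_norm_ball.
- by move=> e _; apply: convex_setI => //; exact: convex_norm_ball.
- exact: ltr01.
- move=> y [_ /= yw]; rewrite -(subrK w y).
  by apply: le_trans (ler_normD _ _) _; rewrite lerD2r.
- have [e e0 es] : exists2 e : R, 0 < e & forall i, i \in s -> e <= i.
    elim: s s0 => [|a s IH] s0; first by exists 1.
    have [|e e0 es] := IH; first by move=> i si; apply: s0; rewrite inE si orbT.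
    have a0 : 0 < a by apply: s0; rewrite mem_head.
    exists (Num.min a e) => [|i]; first by rewrite lt_min a0.
    by rewrite inE ge_min => /orP[/eqP->|/es->]; rewrite ?lexx// orbT.
  have [_ [y Cy <-] yle] := inf_adherent e0 iN.
  exists y => i /es ei; split => //=; apply: ltW; apply: lt_le_trans yle _.
  by rewrite lerD2l.
have Cp : C p by case: (Bp 1 ltr01).
have pinf : `|p - w| <= inf N.
  by apply/ler_addgt0Pr => e /Bp[].
exists p; split => // c Cc.
suff : 2 * inner (w - p) (c - p) <= 0 by rewrite pmulr_rle0.
apply: (@le0_of_le_small _ _ (`|c - p| ^+ 2)) => s s0 s1.
have Cs : C (s *: c + (1 - s) *: p).
  by move/convex_setP: cvC; apply=> //; rewrite !ltW.
have : `|p - w| ^+ 2 <= `|s *: c + (1 - s) *: p - w| ^+ 2.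
  rewrite lerXn2r ?nnegrE//; apply: le_trans pinf _.
  by apply: ge_inf => //; exists (s *: c + (1 - s) *: p).
have -> : s *: c + (1 - s) *: p - w = (p - w) + s *: (c - p).
  by rewrite scalerBr scalerBl scale1r addrCA addrAC.
rewrite (sqr_normD (p - w)) innerZr normrZ exprMn real_normK ?num_real//.
rewrite -[w - p]opprB innerNl => h.
rewrite -(ler_pM2l s0); lra.
Qed.

Lemma projection_nonexpansive C (P : V -> V) :
  (forall w, C (P w) /\ forall c, C c -> inner (w - P w) (c - P w) <= 0) ->
  forall w w', `|P w - P w'| <= `|w - w'|.
Proof.
move=> PP w w'.
have := (PP w).2 _ (PP w').1; have := (PP w').2 _ (PP w).1.
have := cauchy_schwarz (w - w') (P w - P w').
set a := P w; set b := P w' => cs h1 h2.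
have [->|ab] := eqVneq a b; first by rewrite subrr normr0.
have ab0 : 0 < `|a - b| by rewrite normr_gt0 subr_eq0.
rewrite -(ler_pM2r ab0) -expr2 -inner_normE; apply: le_trans cs.
move: h1 h2; rewrite !innerE; lra.
Qed.

End ConvexSets.

(** * A saddle point for finitely many distance constraints *)

Section Saddle.
Context {R : realType} {V : hilbertType R}.

Definition simplex n : set 'rV[R]_n :=
  [set t | (forall i, 0 <= t 0 i) /\ \sum_i t 0 i = 1].

Lemma continuous_sumV (W : normedModType R) (T : topologicalType) (I : finType)
    (f : I -> T -> W) :
  (forall i, continuous (f i)) -> continuous (fun x => \sum_i f i x).
Proof. by move=> cf; apply: continuous_big => //; exact: add_continuous. Qed.

Lemma continuous_weighted_sum (T : topologicalType) (I : finType)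
    (c f : I -> T -> R) :
  (forall i, continuous (c i)) -> (forall i, continuous (f i)) ->
  continuous (fun x => \sum_i c i x * f i x).
Proof.
move=> cc cf; apply: (@continuous_sumV R^o) => i x.
by apply: continuousM; [exact: cc|exact: cf].
Qed.

Lemma continuous_dist_sqr (T : topologicalType) (v : V) (a : R) (f : T -> V) :
  continuous f -> continuous (fun x => `|v - f x| ^+ 2 - a).
Proof.
move=> cf x; apply: (@cvgB R R^o); last exact: cvg_cst.
have cd : {for x, continuous (fun x => `|v - f x|)}.
  apply: (@continuous_comp _ _ _ (fun x => v - f x) Num.norm).
    by apply: cvgB; [exact: cvg_cst|exact: cf].
  exact: norm_continuous.
exact: (continuousM cd cd).
Qed.

Lemma simplex_compact n : compact (@simplex n).
Proof.
pose D := [set t : 'rV[R]_n | forall i, `[0, 1]%classic (t ord0 i)].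
refine (@subclosed_compact _ _ D _ _ _).
- have -> : @simplex n = (\bigcap_i [set t | 0 <= t 0 i]) `&`
                         [set t | \sum_i t 0 i = 1].
    by apply/seteqP; split=> t [h1 h2]; split => // i; [move=> _|]; apply: h1.
  apply: closedI.
    apply: closed_bigI => i _.
    apply: (@preimage_closed _ _ (fun t : 'rV[R]_n => t 0 i) [set x | 0 <= x]).
      by move=> t _; exact: coord_continuous.
    exact: closed_ge.
  apply: (@preimage_closed _ _ (fun t : 'rV[R]_n => \sum_i t 0 i) [set 1]).
    by move=> t _; apply: continuous_sumV => i; exact: coord_continuous.
  exact: closed_eq.
- apply: (@rV_compact R n (fun=> `[0, 1]%classic)) => _; exact: segment_compact.
- move=> t [t0 t1] i /=; rewrite in_itv /= t0 -t1 (bigD1 i) //= lerDl.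
  by apply: sumr_ge0 => j _.
Qed.

(** The constraints that [y] be at distance at most [sqrt (r i)] from [u i] are
    averaged with weights [t].  The average is smallest on [C] at the projection
    of the barycentre, and its least value is a continuous function of [t].  At
    a maximizer [t] no constraint can exceed the average: moving [t] a little
    towards a vertex moves the projection only a little, and the least value
    does not increase. *)
Lemma exists_saddle_point (C : set V) n (u : 'I_n.+1 -> V) (r : 'I_n.+1 -> R) :
  closed C -> convex_set C -> C !=set0 ->
  exists (t : 'I_n.+1 -> R) (p : V),
    [/\ forall i, 0 <= t i, \sum_i t i = 1, C p,
        forall c, C c -> inner (\sum_i t i *: u i - p) (c - p) <= 0 &
        forall i, `|u i - p| ^+ 2 - r i <=
                  \sum_j t j * (`|u j - p| ^+ 2 - r j)].
Proof.
move=> clC cvC C0.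
have /choice[P PP] := fun w => exists_projection w clC cvC C0.
have Plip := projection_nonexpansive PP.
have cP : continuous P.
  move=> w; apply/cvgrPdist_le => e e0; near=> w'.
  apply: le_trans (Plip _ _) _; near: w'.
  by move: e e0; apply/cvgrPdist_le; exact: cvg_id.
pose w (t : 'rV[R]_n.+1) := \sum_i t 0 i *: u i.
pose phi (t : 'rV[R]_n.+1) y := \sum_i t 0 i * (`|u i - y| ^+ 2 - r i).
pose g t := phi t (P (w t)).
have cw : continuous w.
  by apply: continuous_sumV => i t; apply: continuousZr_tmp; exact: coord_continuous.
have cg : continuous g.
  refine (@continuous_weighted_sum _ _ (fun i (t : 'rV[R]_n.+1) => t 0 i)
    (fun i t => `|u i - P (w t)| ^+ 2 - r i) _ _).
    by move=> i t; exact: coord_continuous.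
  move=> i; refine (@continuous_dist_sqr _ (u i) (r i) (fun t => P (w t)) _) => t.
  refine (@continuous_comp _ _ _ w P t _ _); [exact: cw|exact: cP].
have phiV t y : simplex t -> phi t y = `|w t - y| ^+ 2 +
    (\sum_i t 0 i * `|u i - w t| ^+ 2 - \sum_i t 0 i * r i).
  move=> [_ t1]; rewrite /phi.
  under eq_bigr => i _ do rewrite mulrBr.
  by rewrite sumrB (weighted_variance u y t1) addrA.
have gmin t c : simplex t -> C c -> g t <= phi t c.
  move=> St Cc; rewrite /g !phiV// lerD2r.
  have := (PP (w t)).2 _ Cc; set p := P _.
  have -> : w t - c = (w t - p) - (c - p) by rewrite opprB addrA subrK.
  rewrite (sqr_normB (w t - p)); have := sqr_ge0 `|c - p|; lra.
have S0 : @simplex n.+1 !=set0.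
  exists (\row_j (j == ord0)%:R); split => [i|]; first by rewrite mxE ler0n.
  rewrite (bigD1 ord0) //= mxE eqxx big1 ?addr0// => i i0.
  by rewrite mxE (negbTE i0).
have [t /set_mem St tmax] := EVT_max_rV S0 (@simplex_compact n.+1)
  (continuous_subspaceT cg).
have [t0 t1] := St.
exists (t 0), (P (w t)); split => //; [exact: (PP _).1|exact: (PP _).2|].
move=> i; set p := P (w t); rewrite -[leRHS]/(g t).
(* the weights after a step of length [s] towards the vertex [i] *)
pose ts s := (1 - s) *: t + s *: (\row_j (j == i)%:R : 'rV[R]_n.+1).
have tsE s j : ts s 0 j = (1 - s) * t 0 j + s * (j == i)%:R by rewrite !mxE.
have sum_ts (W : lmodType R) (f : 'I_n.+1 -> W) s :
    \sum_j ts s 0 j *: f j = (1 - s) *: \sum_j t 0 j *: f j + s *: f i.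
  under eq_bigr => j _ do rewrite tsE scalerDl -!scalerA.
  rewrite big_split /= -!scaler_sumr; congr (_ + _ *: _).
  rewrite (bigD1 i) //= eqxx scale1r big1 ?addr0// => j ji.
  by rewrite (negbTE ji) scale0r.
pose K := `|u i - w t|; pose a := `|u i - p|.
have step s : 0 < s -> s < 1 ->
    a ^+ 2 - r i - g t <= s * (2 * (a + K) * K + K ^+ 2).
  move=> s0 s1.
  have Sts : simplex (ts s).
    split=> [j|].
      by rewrite tsE addr_ge0// mulr_ge0 ?ler0n ?subr_ge0 ?t0// ltW.
    have := sum_ts R^o (fun=> 1) s; rewrite -!scaler_suml t1 scale1r.
    by rewrite -scalerDl subrK scale1r => <-; rewrite /GRing.scale /= mulr1.
  set q := P (w (ts s)).
  have Cq : C q by exact: (PP _).1.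
  have gts : g (ts s) = (1 - s) * phi t q + s * (`|u i - q| ^+ 2 - r i).
    exact: (sum_ts R^o (fun j => `|u j - q| ^+ 2 - r j) s).
  have le1 : g (ts s) <= g t by apply: tmax; exact: mem_set.
  have le2 := gmin _ _ St Cq.
  have qi : `|u i - q| ^+ 2 - r i <= g t by rewrite gts in le1; nra.
  have qp : `|q - p| <= s * K.
    apply: le_trans (Plip _ _) _; rewrite /w sum_ts -/(w t) scalerBl scale1r.
    rewrite addrAC [w t - _ - _]addrAC subrr add0r addrC -scalerBr normrZ.
    by rewrite gtr0_norm.
  have b0 := normr_ge0 (u i - q); have K0 : 0 <= K := normr_ge0 _.
  have a0 : 0 <= a := normr_ge0 _.
  have ab : a <= `|u i - q| + s * K.
    rewrite /a -[u i - p](subrKA q); apply: le_trans (ler_normD _ _) _.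
    by rewrite lerD2l.
  have ba : `|u i - q| <= a + s * K.
    rewrite -[u i - q](subrKA p); apply: le_trans (ler_normD _ _) _.
    by rewrite lerD2l distrC.
  set b := `|u i - q| in b0 ab ba qi *.
  have sK : s * K <= K by nra.
  have sK0 : 0 <= s * K by nra.
  have : a ^+ 2 <= (b + s * K) ^+ 2 by rewrite lerXn2r ?nnegrE ?addr_ge0.
  have : b * (s * K) <= (a + K) * (s * K) by apply: ler_wpM2r => //; lra.
  have : (s * K) * (s * K) <= K * (s * K) by apply: ler_wpM2r.
  rewrite !expr2; lra.
by have := le0_of_le_small step; rewrite subr_le0.
Unshelve. all: by end_near.
Qed.

End Saddle.

(** * Dimension and conical combinations *)

Section Dimension.
Context {R : realType} {V : lmodType R}.

Lemma le_dimW m n : le_dim V n -> (m <= n)%N -> le_dim V m.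
Proof. by move=> Vn mn k Vk; apply: leq_trans mn (Vn k Vk). Qed.

(** Since [le_dim] quantifies over all finite bases, one of least size is
    chosen. *)
Lemma dim_cases :
  (forall m, le_dim V m) \/ exists2 n, has_dim V n & le_dim V n.
Proof.
have [[n Vn]|noV] := pselect (exists n, has_dim V n); last first.
  by left => m n Vn; exfalso; apply: noV; exists n.
right; have ex : exists n, `[< has_dim V n >] by exists n; apply/asboolP.
case: (ex_minnP ex) => k /asboolP Vk kmin; exists k => // m Vm.
by apply: kmin; apply/asboolP.
Qed.

Lemma dependent_of_has_dim n (T : finType) (e : T -> V) (A : {set T}) :
  has_dim V n -> (n < #|A|)%N ->
  exists c : T -> R, [/\ (exists i, c i != 0),
    forall i, i \notin A -> c i = 0 & \sum_i c i *: e i = 0].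
Proof.
move=> [b [_ bspan]] nA; have /choice[co coE] := bspan.
pose M : 'M[R]_(#|A|, n) := \matrix_(i, j) co (e (enum_val i)) j.
have : kermx M != 0.
  rewrite kermx_eq0 /row_free; apply: contraL nA => /eqP <-.
  by rewrite -leqNgt rank_leq_col.
move=> /matrix0Pn[i0 [j0 K0]]; set K := kermx M in K0.
pose c x := \sum_j K i0 j * (enum_val j == x)%:R.
have cE (W : lmodType R) (f : T -> W) :
    \sum_x c x *: f x = \sum_j K i0 j *: f (enum_val j).
  under eq_bigr => x _ do rewrite scaler_suml.
  rewrite exchange_big /=; apply: eq_bigr => j _.
  rewrite (bigD1 (enum_val j)) //= eqxx mulr1 big1 ?addr0// => x xj.
  by rewrite eq_sym (negbTE xj) mulr0 scale0r.
exists c; split.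
- exists (enum_val j0); rewrite /c (bigD1 j0) //= eqxx mulr1 big1 ?addr0//.
  move=> j jj0; rewrite (inj_eq enum_val_inj) (negbTE jj0); exact: mulr0.
- move=> x xA; apply: big1 => j _; case: eqP => [jx|]; last by rewrite mulr0.
  by move: xA; rewrite -jx enum_valP.
- rewrite cE; under eq_bigr => j _ do rewrite [e _]coE scaler_sumr.
  rewrite exchange_big big1 //= => k _.
  under eq_bigr => j _ do rewrite scalerA.
  rewrite -scaler_suml (_ : \sum_j _ = 0) ?scale0r//.
  have /matrixP/(_ i0 k) := mulmx_ker M.
  rewrite mxE [RHS]mxE => h; rewrite -[RHS]h; apply: eq_bigr => j _.
  by rewrite [M _ _]mxE.
Qed.

(** Carathéodory's theorem for cones: along a linear relation between the
    vectors in use, the coefficients can be changed until one of them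
    vanishes. *)
Lemma conic_caratheodory n (T : finType) (e : T -> V) (t : T -> R) :
  has_dim V n -> (forall i, 0 <= t i) ->
  exists s : T -> R, [/\ forall i, 0 <= s i, forall i, s i != 0 -> t i != 0,
    \sum_i s i *: e i = \sum_i t i *: e i &
    (#|[set i | s i != 0%R]%SET| <= n)%N].
Proof.
move=> Vn; move: {2}(#|_|) (leqnn #|[set i | t i != 0%R]%SET|) => k.
elim: k t => [|k IH] t tk t0.
  by exists t; split => //; apply: leq_trans tk _.
have [tn|nt] := leqP #|[set i | t i != 0%R]%SET| n; first by exists t.
have [c [[i0 ci0] c0 ce]] := dependent_of_has_dim e Vn nt.
wlog ci0_gt0 : c ci0 c0 ce / 0 < c i0.
  move=> wl; have [/wl|] := ltP 0 (c i0); first exact.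
  rewrite le_eqVlt (negbTE ci0) /= => ci0n.
  apply: (wl (fun i => - c i)); rewrite ?oppr_eq0 ?oppr_gt0//.
    by move=> i /c0 ->; rewrite oppr0.
  by under eq_bigr => i _ do rewrite scaleNr; rewrite sumrN ce oppr0.
pose j := [arg min_(i < i0 | 0 < c i) (t i / c i)]%O.
have [cj_gt0 jmin] : 0 < c j /\ forall i, 0 < c i -> t j / c j <= t i / c i.
  by rewrite /j; case: arg_minP.
pose tau := t j / c j.
have tau0 : 0 <= tau by rewrite divr_ge0// ltW.
pose s i := t i - tau * c i.
have s0 i : 0 <= s i.
  rewrite /s subr_ge0; have [ci|ci] := ltP 0 (c i).
    by rewrite -ler_pdivlMr//; exact: jmin.
  by apply: le_trans (t0 i); rewrite mulr_ge0_le0.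
have st i : s i != 0 -> t i != 0.
  apply: contra => /eqP ti; rewrite /s ti c0 ?inE ?ti ?eqxx//.
  by rewrite mulr0 subrr.
have sj : s j = 0 by rewrite /s /tau divfK ?subrr// gt_eqF.
have tj : t j != 0.
  by apply: contraTneq cj_gt0 => tj; rewrite c0 ?ltxx// inE tj eqxx.
have sk : (#|[set i | s i != 0%R]%SET| <= k)%N.
  rewrite -ltnS; apply: leq_trans tk; apply: proper_card.
  apply/properP; split; first by apply/fintype.subsetP => i; rewrite !inE; exact: st.
  by exists j; rewrite !inE // sj eqxx.
have [r [r0 rs re rn]] := IH s sk s0.
exists r; split => //; first by move=> i /rs/st.
rewrite re; under eq_bigr => i _ do rewrite scalerBl -scalerA.
by rewrite sumrB -scaler_sumr ce scaler0 subr0.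
Qed.

End Dimension.

(** * Common points of finitely many balls and a convex set *)

Section ContractionToExtension.
Context {R : realType} {Z Y : hilbertType R} {X : set Z} {v : Z -> Y}.
Context (contr : convex_comb_contraction X v).

(** The points without weight do not count towards the dimension bound. *)
Lemma contraction_of_support (T : finType) (x : Z) (xs : T -> Z) (s : T -> R) :
  X x -> (forall i, X (xs i)) -> (forall i, 0 <= s i) -> \sum_i s i = 1 ->
  le_dim Y #|[set i | s i != 0%R]%SET| ->
  `|v x - \sum_i s i *: v (xs i)| <= `|x - \sum_i s i *: xs i|.
Proof.
move=> Xx Xxs s0 s1; set A := finset _ => Yd.
have sE (W : lmodType R) (f : T -> W) : \sum_i s i *: f i =
    \sum_(i < #|A|) s (enum_val i) *: f (enum_val i).
  rewrite -(big_enum_val (fun i => s i *: f i)) [RHS]big_mkcond /=.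
  by apply: eq_bigr => i _; rewrite inE; case: eqP => //= ->; rewrite scale0r.
have s1' : \sum_(i < #|A|) s (enum_val i) = 1.
  rewrite -s1; have := sE R^o (fun=> 1); rewrite -!scaler_suml.
  by rewrite /GRing.scale /= !mulr1 => ->.
have A0 : (0 < #|A|)%N.
  rewrite lt0n; apply/eqP => A0; move: s1'; rewrite big1 => [|i _].
    by move/eqP; rewrite eq_sym oner_eq0.
  by have := leq_trans (ltn_ord i) (eq_leq A0).
by rewrite !sE; apply: contr => // i; exact: s0.
Qed.

(** At a saddle point with positive value the constraints that carry weight are
    all exceeded by the same amount, so the weights may be redistributed among
    them.  The normal vector from [p] to the barycentre of the [us i] is
    rewritten with at most [dim Y] of these constraints.  Since
    [v x + \sum_i s i (us i - v (xs i))] lies in [v x + K], that vector, for the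
    normalized new weights [s], is no longer than
    [v x - \sum_i s i v (xs i)], which [contr] compares with
    [x - \sum_i s i xs i]; the inequality between weighted squared distances
    and barycentres then forbids the excess. *)
Lemma finite_common_point (K : set Y) n (x : Z) (xs : 'I_n.+1 -> Z)
    (us : 'I_n.+1 -> Y) :
  closed K -> convex_set K ->
  X x -> (forall i, X (xs i)) -> (forall i, K (us i - v (xs i))) ->
  (forall i j, `|us i - us j| <= `|xs i - xs j|) ->
  exists y, K (y - v x) /\ forall i, `|us i - y| <= `|xs i - x|.
Proof.
move=> clK cvK Xx Xxs Ku lip.
pose C := [set y | K (y - v x)].
have clC : closed C by exact: closed_translate.
have cvC : convex_set C by exact: convex_translate.
have C0 : C !=set0.
  by exists (us ord0 - v (xs ord0) + v x); rewrite /C /= addrK.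
have [t [p [t0 t1 Cp pn]]] :=
  exists_saddle_point us (fun i => `|xs i - x| ^+ 2) clC cvC C0.
pose f i := `|us i - p| ^+ 2 - `|xs i - x| ^+ 2.
rewrite -[\sum_j t j * _]/(\sum_j t j * f j); set g := \sum_j _ => fg.
suff g0 : g <= 0.
  exists p; split => // i; rewrite -(@ler_pXn2r _ 2)// ?nnegrE// -subr_le0.
  exact: le_trans (fg i) g0.
rewrite leNgt; apply/negP => g_gt0.
have slack i : t i != 0 -> f i = g.
  move=> ti; have : \sum_j t j * (g - f j) = 0.
    under eq_bigr => j _ do rewrite mulrBr.
    by rewrite sumrB -mulr_suml t1 mul1r subrr.
  have ge0 j : true -> 0 <= t j * (g - f j).
    by move=> _; rewrite mulr_ge0// subr_ge0; exact: fg.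
  move=> /eqP; rewrite psumr_eq0// => /allP/(_ i (mem_index_enum _)) /=.
  by rewrite mulf_eq0 (negbTE ti) subr_eq0 => /eqP.
have baryp (s : 'I_n.+1 -> R) : \sum_i s i = 1 ->
    \sum_i s i *: (us i - p) = \sum_i s i *: us i - p.
  move=> s1; under eq_bigr => i _ do rewrite scalerBr.
  by rewrite sumrB -scaler_suml s1 scale1r.
have [s [s0 st se sd]] : exists s : 'I_n.+1 -> R, [/\ forall i, 0 <= s i,
    forall i, s i != 0 -> t i != 0,
    \sum_i s i *: (us i - p) = \sum_i t i *: (us i - p) &
    le_dim Y #|[set i | s i != 0%R]%SET|].
  have [Yd|[d Yd Yle]] := @dim_cases R Y; first by exists t; split.
  have [s [s0 st se sd]] := conic_caratheodory (fun i => us i - p) Yd t0.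
  by exists s; split => //; exact: le_dimW Yle sd.
pose q := \sum_i s i *: (us i - p).
have qn c : C c -> inner q (c - p) <= 0.
  by rewrite /q se (baryp _ t1); exact: pn.
have [q0|q0] := eqVneq q 0.
  (* [p] is itself the barycentre, as in Kirszbraun's theorem *)
  have := lip_barycentre x p t0 t1 lip; rewrite -/g -(baryp _ t1) -se -/q q0.
  by rewrite normr0; have := sqr_ge0 `|\sum_i t i *: xs i - x|; lra.
pose a := \sum_i s i.
have a_gt0 : 0 < a.
  rewrite lt_neqAle sumr_ge0 ?andbT//; apply: contra q0 => /eqP/esym a0.
  rewrite /q big1// => i _.
  have /eqP := a0; rewrite psumr_eq0// => /allP/(_ i (mem_index_enum _)).
  by move=> /= /eqP ->; rewrite scale0r.
pose s' i := s i / a.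
have s'0 i : 0 <= s' i by rewrite divr_ge0// ltW.
have s'1 : \sum_i s' i = 1 by rewrite -mulr_suml divff// gt_eqF.
have s'd : le_dim Y #|[set i | s' i != 0%R]%SET|.
  apply: le_dimW sd _; apply: subset_leq_card; apply/fintype.subsetP => i.
  by rewrite !inE; apply: contra => /eqP; rewrite /s' => ->; rewrite mul0r.
have gs' : \sum_i s' i * f i = g.
  rewrite -[RHS]mul1r -s'1 mulr_suml; apply: eq_bigr => i _.
  have [si|/st/slack ->//] := eqVneq (s i) 0.
  by rewrite /s' si !mul0r.
pose w := \sum_i s' i *: us i.
have wp : w - p = a^-1 *: q.
  rewrite /w -baryp// scaler_sumr; apply: eq_bigr => i _.
  by rewrite scalerA mulrC.
pose c := w - \sum_i s' i *: v (xs i) + v x.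
have Cc : C c.
  rewrite /C /= addrK -sumrB; under eq_bigr => i _ do rewrite -scalerBr.
  exact: (convex_sum cvK).
have wn : inner (w - p) (c - p) <= 0.
  by rewrite wp innerZl pmulr_rle0 ?invr_gt0//; exact: qn.
have wle : `|w - p| <= `|v x - \sum_i s' i *: v (xs i)|.
  have [->|wp0] := eqVneq (w - p) 0; first by rewrite normr0.
  rewrite -(@ler_pM2l _ `|w - p|) ?normr_gt0//.
  have := cauchy_schwarz (w - p) (- (v x - \sum_i s' i *: v (xs i))).
  rewrite normrN; apply: le_trans; rewrite -expr2 -inner_normE innerNr.
  move: wn; rewrite /c -[_ - _ + _ - p]addrA [in X in inner _ X]addrAC.
  rewrite !innerE; lra.
have := lip_barycentre x p s'0 s'1 lip; rewrite gs' -/w.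
have := contraction_of_support Xx Xxs s'0 s'1 s'd.
rewrite [in leRHS]distrC => vx.
have := le_trans wle vx; rewrite -(@ler_pXn2r _ 2)// ?nnegrE//.
lra.
Qed.

End ContractionToExtension.

(** * One-point extensions and their iteration *)

Section Extension.
Context {R : realType} {Z Y : hilbertType R} {X : set Z} {v : Z -> Y}.

Lemma lipschitzP (A : set Z) (u : Z -> Y) : 1.-lipschitz_A u <->
  forall x y, A x -> A y -> `|u x - u y| <= `|x - y|.
Proof.
split=> [lu x y Ax Ay|lu [x y] [/= Ax Ay]].
  by have := lu (x, y) (conj Ax Ay); rewrite /= mul1r.
by rewrite mul1r; exact: lu.
Qed.

(** Partial maps are handled through their graphs: the second clause makes
    [G] the graph of a 1-Lipschitz function on its domain. *)
Definition admissible_graph (K : set Y) (G : set (Z * Y)) :=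
  (forall p, G p -> X p.1 /\ K (p.2 - v p.1)) /\
  (forall p q, G p -> G q -> `|p.2 - q.2| <= `|p.1 - q.1|).

Lemma one_point_extension (K : set Y) (G : set (Z * Y)) (x : Z) :
  convex_comb_contraction X v ->
  K !=set0 -> closed K -> convex_set K -> admissible_graph K G -> X x ->
  exists y, K (y - v x) /\ forall p, G p -> `|p.2 - y| <= `|p.1 - x|.
Proof.
move=> contr [k Kk] clK cvK [GK Glip] Xx.
have [[p0 Gp0]|G0] := pselect (G !=set0); last first.
  exists (k + v x); split; first by rewrite addrK.
  by move=> p Gp; exfalso; apply: G0; exists p.
pose C (p : Z * Y) := [set y | K (y - v x)] `&`
                      [set y : Y | `|y - p.2| <= `|p.1 - x|].
have [|||||y yP] := @bounded_closed_convex_fip R Y _ G C p0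
    (`|p0.1 - x| + `|p0.2|).
- by move=> p _; apply: closedI; [exact: closed_translate|exact: closed_norm_ball].
- move=> p _; apply: convex_setI; first exact: convex_translate.
  exact: convex_norm_ball.
- by [].
- move=> y [_ /= yp]; rewrite -[y](subrK p0.2).
  by apply: le_trans (ler_normD _ _) _; rewrite lerD2r.
- move=> s sG; pose e (i : 'I_(size s).+1) := nth p0 (p0 :: s) i.
  have Ge i : G (e i).
    have : e i \in p0 :: s by rewrite mem_nth.
    by rewrite inE => /orP[/eqP ->|/sG].
  have [y [Ky yP]] := finite_common_point (us := fun i => (e i).2) contr
    clK cvK Xx (fun i => (GK _ (Ge i)).1) (fun i => (GK _ (Ge i)).2)
    (fun i j => Glip _ _ (Ge i) (Ge j)).
  exists y => p ps; split => //=.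
  have lt_ps : ((index p s).+1 < (size s).+1)%N by rewrite ltnS index_mem.
  have := yP (Ordinal lt_ps).
  by rewrite /e /= nth_index// distrC.
exists y; split; first by case: (yP p0 Gp0).
by move=> p /yP[_ yp]; rewrite distrC.
Qed.

(** A maximal admissible extension of the graph of [u] is defined on all of
    [X], because otherwise a further point could be added. *)
Lemma convex_extension_of_contraction :
  convex_comb_contraction X v -> convex_extension X v.
Proof.
move=> contr K K0 clK cvK A AX u /lipschitzP lu uK.
pose Gu : set (Z * Y) := [set p | A p.1 /\ p.2 = u p.1].
pose Adm (G : set (Z * Y)) := admissible_graph K (G `|` Gu).
have Adm0 : admissible_graph K Gu.
  split=> [[x y] [/= Ax ->]|[x y] [x' y'] [/= Ax ->] [/= Ax' ->]].
    by split; [exact: AX|exact: uK].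
  exact: lu.
have [F FAdm Ftot|G [[GK Glip] Gmax]] := @Zorn_bigcup _ Adm.
  split=> [p [[G FG Gp]|Gup]|p q].
  - by have [+ _] := FAdm _ FG; apply; left.
  - by have [+ _] := Adm0; apply.
  - move=> [[G FG Gp]|Gup] [[H FH Hq]|Guq].
    + have [GH|HG] := Ftot _ _ FG FH.
        have [_ +] := FAdm _ FH; apply; left => //; exact: GH.
      have [_ +] := FAdm _ FG; apply; left => //; exact: HG.
    + by have [_ +] := FAdm _ FG; apply; [left|right].
    + by have [_ +] := FAdm _ FH; apply; [right|left].
    + by have [_ +] := Adm0; apply.
have total x : X x -> exists y, (G `|` Gu) (x, y).
  move=> Xx; apply: contrapT => nex.
  have [y [Ky yP]] := one_point_extension contr K0 clK cvK (conj GK Glip) Xx.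
  have nGxy : ~ G (x, y) by move=> Gxy; apply: nex; exists y; left.
  apply: (Gmax (G `|` [set (x, y)])).
    split; first by move=> p; left.
    by move=> sub; apply: nGxy; apply: sub; right.
  have GE p : ((G `|` [set (x, y)]) `|` Gu) p -> (G `|` Gu) p \/ p = (x, y).
    by move=> [[Gp|->]|Gup]; [left; left|right|left; right].
  split=> [p /GE[/GK//|->//]|p q /GE[Gp|->] /GE[Gq|->]].
  - exact: Glip.
  - exact: yP.
  - by rewrite distrC [leRHS]distrC; exact: yP.
  - by rewrite !subrr !normr0.
have /choice[ut utP] : forall x, exists y, X x -> (G `|` Gu) (x, y).
  move=> x; have [/total[y Gy]|nXx] := pselect (X x); first by exists y.
  by exists 0 => /nXx.
exists ut; split; first split.
- apply/lipschitzP => x y Xx Xy.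
  exact: (Glip (x, ut x) (y, ut y) (utP _ Xx) (utP _ Xy)).
- move=> x Ax; have Gux : (G `|` Gu) (x, u x) by right.
  have := Glip _ _ (utP _ (AX _ Ax)) Gux.
  by rewrite /= subrr normr0 normr_le0 subr_eq0 => /eqP.
- by move=> x Xx; have [_] := GK _ (utP _ Xx).
Qed.

Lemma ball_extension_of_convex_extension :
  convex_extension X v -> ball_extension X v.
Proof.
move=> ext A AX d d0 u lu ud.
pose K : set Y := [set y | `|y| <= d].
have KE : K = [set y : Y | `|y - 0| <= d].
  by apply/seteqP; split => y; rewrite /K /= subr0.
have [|||ut utP] := ext K _ _ _ A AX u lu ud; last by exists ut.
- by exists 0; rewrite /K /= normr0.
- by rewrite KE; exact: closed_norm_ball.
- by rewrite KE; exact: convex_norm_ball.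
Qed.

End Extension.

(** * Orthonormal vectors *)

Section Orthonormal.
Context {R : realType} {V : hilbertType R}.

Lemma sqr_inner_unit (e y : V) : `|e| = 1 -> inner y e ^+ 2 <= `|y| ^+ 2.
Proof.
move=> e1; rewrite -[leLHS]real_normK ?num_real// lerXn2r ?nnegrE// ler_norml.
have := cauchy_schwarz y e; have := cauchy_schwarz (- y) e.
by rewrite innerNl normrN e1 mulr1 => h1 h2; apply/andP; split; lra.
Qed.

(** Otherwise the orthonormal family would be a basis with [k] elements. *)
Lemma exists_orthogonal_unit k (es : 'I_k -> V) :
  le_dim V k.+1 -> (forall i j, inner (es i) (es j) = (i == j)%:R) ->
  exists f, `|f| = 1 /\ forall i, inner f (es i) = 0.
Proof.
move=> Vk on; apply: contrapT => nof.
have coef (c : 'I_k -> R) j : inner (\sum_i c i *: es i) (es j) = c j.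
  rewrite inner_suml (bigD1 j) //= innerZl on eqxx mulr1 big1 ?addr0//.
  by move=> i ij; rewrite innerZl on (negbTE ij) mulr0.
suff : has_dim V k by move/Vk; rewrite ltnn.
exists es; split=> [c c0 j|y]; first by rewrite -(coef c) c0 inner0l.
exists (fun i => inner y (es i)); set p := \sum_i _.
apply/eqP; rewrite -subr_eq0; apply/eqP; apply: contrapT => /eqP yp.
apply: nof; exists (`|y - p|^-1 *: (y - p)); split=> [|i].
  by rewrite normrZ normfV normr_id mulVf// normr_eq0.
by rewrite innerZl innerDl innerNl coef subrr mulr0.
Qed.

End Orthonormal.

(** The form in the hypothesis is the Gram form of the triangle with squared
    sides [a], [b] and [c]; the triangle is placed with one vertex at the origin
    and a second one on the axis. *)
Lemma exists_planar_triangle (R : realType) (a b c : R) :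
  0 <= a -> 0 <= b ->
  (forall p q, 0 <= p ^+ 2 * a + p * q * (a + b - c) + q ^+ 2 * b) ->
  exists x y z : R, [/\ x ^+ 2 = a, y ^+ 2 + z ^+ 2 = b &
                        (x - y) ^+ 2 + z ^+ 2 = c].
Proof.
move=> a0 b0 psd; pose h := (a + b - c) / 2.
have cE : c = a + b - 2 * h by rewrite /h; field.
have [a_eq0|a_neq0] := eqVneq a 0.
  have h0 : h = 0.
    apply: contrapT => /eqP h0; have := psd (- (b + 1) / h) 1.
    rewrite cE a_eq0.
    have -> : (- (b + 1) / h) ^+ 2 * 0 + - (b + 1) / h * 1 *
      (0 + b - (0 + b - 2 * h)) + 1 ^+ 2 * b = - b - 2 by field.
    lra.
  by exists 0, 0, (Num.sqrt b); split; rewrite ?sqr_sqrtr// ?cE ?h0 ?a_eq0; ring.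
have a_gt0 : 0 < a by rewrite lt_neqAle eq_sym a_neq0.
have disc : 0 <= b - h ^+ 2 / a.
  have := psd (- h) a; rewrite cE => hpsd.
  rewrite subr_ge0 ler_pdivrMr// -(ler_pM2l a_gt0); lra.
exists (Num.sqrt a), (h / Num.sqrt a), (Num.sqrt (b - h ^+ 2 / a)).
have sa0 : Num.sqrt a != 0 by rewrite sqrtr_eq0 -ltNge.
have e1 : (h / Num.sqrt a) ^+ 2 = h ^+ 2 / a by rewrite expr_div_n sqr_sqrtr.
split; first exact: sqr_sqrtr.
  by rewrite e1 sqr_sqrtr// subrKC.
rewrite sqrrB e1 !sqr_sqrtr// [X in _ - X *+ 2]mulrC divfK// cE; ring.
Qed.

(** * Extensions at a bounded distance give contraction *)

Section ExtensionToContraction.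
Context {R : realType} {Z Y : hilbertType R} {X : set Z} {v : Z -> Y}.
Context (ext : ball_extension X v).

(** With empty domain and distance zero, the extension can only be [v]. *)
Lemma lipschitz_of_ball_extension x y :
  X x -> X y -> `|v x - v y| <= `|x - y|.
Proof.
move=> Xx Xy.
have [] := ext (@sub0set _ X) (lexx 0) (u := v); first by move=> ? [[]].
  by [].
move=> ut [[/lipschitzP lut _] utv].
have E z : X z -> ut z = v z.
  by move=> /utv; rewrite normr_le0 subr_eq0 => /eqP.
by rewrite -!E//; exact: lut.
Qed.

(** Extending [v + d e] with a bound slightly above [d], for large [d], amounts
    to keeping the [e]-component of the extension below that of [v] up to a
    small error.  The points [v (xs i)] are first replaced by points with the
    same [e]-components, but at the same mutual distances as the [xs i]: then
    the distances that the extension has to keep at [x] determine how far it is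
    from the barycentre. *)
Lemma component_bound (T : finType) (xs : T -> Z) (h : T -> Y) (t : T -> R)
    (x : Z) (e : Y) :
  X x -> (forall i, X (xs i)) -> (forall i, 0 <= t i) -> \sum_i t i = 1 ->
  `|e| = 1 -> (forall i, inner (h i) e = 0) ->
  (forall i j, `|h i - h j| ^+ 2 =
     `|xs i - xs j| ^+ 2 - inner (v (xs i) - v (xs j)) e ^+ 2) ->
  inner (\sum_i t i *: v (xs i) - v x) e <= `|x - \sum_i t i *: xs i|.
Proof.
move=> Xx Xxs t0 t1 e1 he hd.
have ee : inner e e = 1 by rewrite inner_normE e1 expr1n.
pose us i := inner (v (xs i)) e *: e + h i.
have use i : inner (us i) e = inner (v (xs i)) e.
  by rewrite /us innerDl innerZl ee he mulr1 addr0.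
have usd i j : `|us i - us j| = `|xs i - xs j|.
  apply/eqP; rewrite -(@eqrXn2 _ 2)//; apply/eqP.
  have -> : us i - us j = inner (v (xs i) - v (xs j)) e *: e + (h i - h j).
    by rewrite /us innerDl innerNl scalerDl scaleNr opprD addrACA.
  rewrite sqr_normD hd normrZ e1 mulr1 real_normK ?num_real//.
  by rewrite innerZl innerDr innerNr ![inner e _]innerC !he; ring.
have uds i j : `|xs i - xs j| <= `|us i - us j| by rewrite usd.
pose M := \sum_i `|us i - v (xs i)| ^+ 2.
have M0 : 0 <= M by apply: sumr_ge0.
rewrite -subr_le0; apply: (@le0_of_le_small _ _ M) => s s0 s1.
(* the shift [d] is [1 / s], and the bound [d'] exceeds it by at most [s * M] *)
pose d : R := s^-1; have d0 : 0 < d by rewrite invr_gt0.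
pose d' : R := Num.sqrt (d ^+ 2 + M).
have d'0 : 0 <= d' by exact: sqrtr_ge0.
have d'2 : d' ^+ 2 = d ^+ 2 + M by rewrite sqr_sqrtr// addr_ge0// sqr_ge0.
have d'd : d' - d <= s * M.
  have dd' : d <= d' by rewrite -(@ler_pXn2r _ 2)// ?nnegrE ?(ltW d0)// d'2 lerDl.
  rewrite -(ler_pM2l d0) mulrA mulVf ?gt_eqF// mul1r.
  have : (d' - d) * d <= (d' - d) * (d' + d).
    by rewrite ler_wpM2l ?subr_ge0// lerDr.
  by rewrite -subr_sqr d'2; lra.
(* [xs] may repeat points; [us] then repeats its values, being isometric *)
have /choice[u uE] : forall z, exists y, forall i, xs i = z -> y = us i + d *: e.
  move=> z; have [[i <-]|nz] := pselect (exists i, xs i = z).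
    exists (us i + d *: e) => j ji; congr (_ + _); apply/eqP.
    by rewrite -subr_eq0 -normr_eq0 usd ji subrr normr0.
  by exists 0 => i iz; exfalso; apply: nz; exists i.
have AX : range xs `<=` X by move=> _ [i _ <-].
have lu : 1.-lipschitz_(range xs) u.
  apply/lipschitzP => _ _ [i _ <-] [j _ <-].
  by rewrite !(uE _ _ erefl) opprD addrACA subrr addr0 usd.
have ud z : range xs z -> `|u z - v z| <= d'.
  move=> [i _ <-]; rewrite (uE _ _ erefl) addrAC.
  rewrite -(@ler_pXn2r _ 2)// ?nnegrE// sqr_normD d'2 innerZr.
  rewrite innerDl innerNl use subrr !mulr0 addr0 normrZ e1 mulr1.
  rewrite real_normK ?num_real// [leRHS]addrC lerD2r /M (bigD1 i) //= lerDl.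
  by apply: sumr_ge0 => j _.
have [ut [[/lipschitzP lut utE] utd]] := ext AX d'0 lu ud.
pose y := ut x - d *: e.
have yle i : `|us i - y| <= `|xs i - x|.
  have -> : us i - y = ut (xs i) - ut x.
    by rewrite utE ?(uE _ _ erefl)// /y opprB addrA addrAC.
  by apply: lut => //; exact: Xxs.
pose w := \sum_i t i *: us i; pose z := \sum_i t i *: xs i.
have wy : `|w - y| <= `|x - z|.
  rewrite [leRHS]distrC -(@ler_pXn2r _ 2)// ?nnegrE//.
  have := lip_barycentre (z := us) (u := xs) y x t0 t1
    uds.
  have : 0 <= \sum_i t i * (`|xs i - x| ^+ 2 - `|us i - y| ^+ 2).
    by apply: sumr_ge0 => i _; rewrite mulr_ge0// subr_ge0 lerXn2r ?nnegrE.
  rewrite -/w -/z; lra.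
have we : inner w e = inner (\sum_i t i *: v (xs i)) e.
  rewrite !inner_suml; apply: eq_bigr => i _.
  by rewrite !innerZl use.
have ye : inner y e <= inner (v x) e + (d' - d).
  have := cauchy_schwarz (ut x - v x) e; rewrite e1 mulr1 => cs.
  have := le_trans cs (utd _ Xx); rewrite /y !innerE ee.
  by rewrite mulr1 addrA lerD2r lerBlDl.
have := cauchy_schwarz (w - y) e; rewrite e1 mulr1 => cs.
have := le_trans cs wy.
rewrite (innerDl w) (innerDl (\sum_i _)) !innerNl we -/z; lra.
Qed.

(** The component that matters is the one along the vector to be estimated; the
    points with these components are searched in the form
    [inner (v (xs i)) e *: e + h i] with [h i] orthogonal to [e]. *)
Lemma contraction_of_components (T : finType) (xs : T -> Z) (t : T -> R)
    (x : Z) :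
  X x -> (forall i, X (xs i)) -> (forall i, 0 <= t i) -> \sum_i t i = 1 ->
  (forall e, `|e| = 1 -> exists h : T -> Y, (forall i, inner (h i) e = 0) /\
     forall i j, `|h i - h j| ^+ 2 =
       `|xs i - xs j| ^+ 2 - inner (v (xs i) - v (xs j)) e ^+ 2) ->
  `|v x - \sum_i t i *: v (xs i)| <= `|x - \sum_i t i *: xs i|.
Proof.
move=> Xx Xxs t0 t1 lift; rewrite distrC; set q := _ - v x.
have [->|q0] := eqVneq q 0; first by rewrite normr0.
have e1 : `|(`|q|^-1 *: q)| = 1.
  by rewrite normrZ normfV normr_id mulVf// normr_eq0.
have [h [he hd]] := lift _ e1.
have := component_bound Xx Xxs t0 t1 e1 he hd.
by rewrite innerZr inner_normE expr2 mulKf// normr_eq0.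
Qed.

Lemma defect_ge0 (x y : Z) (e : Y) : X x -> X y -> `|e| = 1 ->
  0 <= `|x - y| ^+ 2 - inner (v x - v y) e ^+ 2.
Proof.
move=> Xx Xy e1; rewrite subr_ge0.
apply: le_trans (sqr_inner_unit _ e1) _.
by rewrite lerXn2r ?nnegrE//; exact: lipschitz_of_ball_extension.
Qed.

Lemma two_point_contraction (x x1 x2 : Z) (s : R) : le_dim Y 2 ->
  X x -> X x1 -> X x2 -> 0 <= s <= 1 ->
  `|v x - (s *: v x1 + (1 - s) *: v x2)| <= `|x - (s *: x1 + (1 - s) *: x2)|.
Proof.
move=> Y2 Xx X1 X2 /andP[s0 s1].
have := @contraction_of_components bool (fun b => if b then x1 else x2)
  (fun b => if b then s else 1 - s) x Xx.
rewrite !big_bool /=; apply => [[]//|[]//||e e1].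
- by rewrite subr_ge0.
- by rewrite subrKC.
have [f [f1 fe]] := exists_orthogonal_unit (es := fun _ : 'I_1 => e) Y2
  (fun i j => ltac:(by rewrite !ord1 inner_normE e1 expr1n)).
pose D := `|x1 - x2| ^+ 2 - inner (v x1 - v x2) e ^+ 2.
have D0 : 0 <= D by exact: defect_ge0.
exists (fun b => if b then Num.sqrt D *: f else 0); split=> [[]|[] []].
- by rewrite innerZl (fe ord0) mulr0.
- by rewrite inner0l.
- by rewrite !subrr inner0l !normr0; ring.
- by rewrite subr0 normrZ f1 mulr1 real_normK ?num_real// sqr_sqrtr.
- rewrite sub0r normrN normrZ f1 mulr1 real_normK ?num_real// sqr_sqrtr//.
  by rewrite /D distrC -[v x1 - v x2]opprB innerNl sqrrN.
- by rewrite !subrr inner0l !normr0; ring.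
Qed.

Lemma cone_contraction (x x1 x2 : Z) (a b : R) : le_dim Y 2 ->
  X x -> X x1 -> X x2 -> 0 <= a -> 0 <= b ->
  `|a *: (v x1 - v x) + b *: (v x2 - v x)| <=
  `|a *: (x1 - x) + b *: (x2 - x)|.
Proof.
move=> Y2 Xx X1 X2 a0 b0; have [ab0|abn0] := eqVneq (a + b) 0.
  have [-> ->] : a = 0 /\ b = 0 by split; lra.
  by rewrite !scale0r !addr0 !normr0.
have ab0 : 0 < a + b by rewrite lt_neqAle eq_sym abn0 addr_ge0.
have scaled (W : normedModType R) (w w1 w2 : W) :
    a *: (w1 - w) + b *: (w2 - w) =
    - ((a + b) *: (w - ((a / (a + b)) *: w1 + (1 - a / (a + b)) *: w2))).
  have -> : 1 - a / (a + b) = b / (a + b) by field.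
  rewrite !scalerBr scalerDr !scalerA ![(a + b) * _]mulrC !divfK// opprB.
  by rewrite scalerDl opprD addrACA.
rewrite !scaled !normrN !normrZ ler_wpM2l//.
apply: two_point_contraction => //.
apply/andP; split; first by rewrite divr_ge0// ltW.
by rewrite ler_pdivrMr// mul1r lerDl.
Qed.

(** Of the three coefficients [b], [c] and [- (b + c)], two have the same sign;
    the remaining point serves as the apex of a cone. *)
Lemma triangle_contraction (x0 x1 x2 : Z) (b c : R) : le_dim Y 2 ->
  X x0 -> X x1 -> X x2 ->
  `|b *: (v x1 - v x0) + c *: (v x2 - v x0)| <=
  `|b *: (x1 - x0) + c *: (x2 - x0)|.
Proof.
move=> Y2.
have flip (W : normedModType R) (w w1 w2 : W) b' c' :
    `|b' *: (w1 - w) + c' *: (w2 - w)| =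
    `|(- c') *: (w2 - w1) + (b' + c') *: (w - w1)|.
  have -> : w2 - w1 = (w2 - w) - (w1 - w) by rewrite opprB addrA subrK.
  rewrite -[w - w1]opprB -normrN; congr `|_|.
  move: (w1 - w) (w2 - w) => p q.
  rewrite scalerBr scalerN -addrA -opprD -scalerDl addrCA addNr addr0.
  by rewrite scaleNr -opprD addrC.
have negated (W : normedModType R) (p q : W) b' c' :
    `|b' *: p + c' *: q| = `|(- b') *: p + (- c') *: q|.
  by rewrite !scaleNr -opprD normrN.
have mixed (b' c' : R) (z0 z1 z2 : Z) : X z0 -> X z1 -> X z2 ->
    0 <= b' -> c' <= 0 ->
    `|b' *: (v z1 - v z0) + c' *: (v z2 - v z0)| <=
    `|b' *: (z1 - z0) + c' *: (z2 - z0)|.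
  move=> X0 X1 X2 b0 c0; have [bc|bc] := leP 0 (b' + c').
    by rewrite flip [leRHS]flip; apply: cone_contraction; rewrite ?oppr_ge0.
  rewrite negated [leRHS]negated addrC [X in _ <= `|X|]addrC.
  rewrite flip [leRHS]flip opprK -opprD.
  by apply: cone_contraction; rewrite // oppr_ge0 addrC ltW.
move=> X0 X1 X2; have [b0|/ltW b0] := leP 0 b; have [c0|/ltW c0] := leP 0 c.
- exact: cone_contraction.
- exact: mixed.
- by rewrite addrC [b *: (x1 - x0) + _]addrC; exact: mixed.
- rewrite negated [leRHS]negated.
  by apply: cone_contraction; rewrite ?oppr_ge0.
Qed.

(** For a unit vector [e], the squared distances of three points of [X],
    diminished by the squared differences of the [e]-components of [v], still come from a
    positive semidefinite form, by the contraction property for two points.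
    Two dimensions orthogonal to [e] suffice to realize it. *)
Lemma three_point_contraction (x : Z) (xs : 'I_3 -> Z) (t : 'I_3 -> R) :
  le_dim Y 3 -> X x -> (forall i, X (xs i)) -> (forall i, 0 <= t i) ->
  \sum_i t i = 1 ->
  `|v x - \sum_i t i *: v (xs i)| <= `|x - \sum_i t i *: xs i|.
Proof.
move=> Y3 Xx Xxs t0 t1; apply: contraction_of_components => // e e1.
have ee : inner e e = 1 by rewrite inner_normE e1 expr1n.
have Y2 : le_dim Y 2 by exact: le_dimW Y3 _.
have [f [f1 fe]] := exists_orthogonal_unit (es := fun _ : 'I_1 => e) Y2
  (fun i j => ltac:(by rewrite !ord1 ee)).
have {}fe : inner f e = 0 := fe ord0.
have ff : inner f f = 1 by rewrite inner_normE f1 expr1n.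
have [|g [g1 gef]] := exists_orthogonal_unit
    (es := fun i : 'I_2 => if i == ord0 then e else f) Y3.
  by move=> [[|[|//]] ip] [[|[|//]] jp] /=; rewrite ?ee ?ff ?fe// innerC fe.
have ge : inner g e = 0 by have := gef ord0.
have gf : inner g f = 0 by have := gef ord_max.
have gg : inner g g = 1 by rewrite inner_normE g1 expr1n.
pose i0 : 'I_3 := ord0; pose i1 : 'I_3 := @Ordinal 3 1 isT.
pose i2 : 'I_3 := @Ordinal 3 2 isT.
pose D i j := `|xs i - xs j| ^+ 2 - inner (v (xs i) - v (xs j)) e ^+ 2.
have DC i j : D i j = D j i.
  by rewrite /D distrC -[v (xs i) - _]opprB innerNl sqrrN.
have [||p q|a [b [c [ha hb hc]]]] :=
    @exists_planar_triangle R (D i1 i0) (D i2 i0) (D i1 i2).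
- exact: defect_ge0.
- exact: defect_ge0.
- have := triangle_contraction p q Y2 (Xxs i0) (Xxs i1) (Xxs i2).
  set P := xs i1 - xs i0; set Q := xs i2 - xs i0.
  set vP := v (xs i1) - v (xs i0); set vQ := v (xs i2) - v (xs i0) => tri.
  have : inner (p *: vP + q *: vQ) e ^+ 2 <= `|p *: P + q *: Q| ^+ 2.
    by apply: le_trans (sqr_inner_unit _ e1) _; rewrite lerXn2r ?nnegrE.
  rewrite /D -/P -/Q -/vP -/vQ.
  have -> : xs i1 - xs i2 = P - Q by rewrite /P /Q opprB addrA subrK.
  have -> : v (xs i1) - v (xs i2) = vP - vQ.
    by rewrite /vP /vQ opprB addrA subrK.
  clearbody P Q vP vQ.
  rewrite -!inner_normE !innerE (innerC Q P); lra.
pose h (i : 'I_3) := nth 0 [:: 0; a *: f; b *: f + c *: g] i.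
exists h; split=> [[[|[|[|//]]] ip]|i j] /=; rewrite ?inner0l//.
- by rewrite innerZl fe mulr0.
- by rewrite innerDl !innerZl fe ge !mulr0 addr0.
rewrite -[RHS]/(D i j).
have h10 : `|h i1 - h i0| ^+ 2 = D i1 i0.
  by rewrite -ha -inner_normE /h /= !innerE ff; ring.
have h20 : `|h i2 - h i0| ^+ 2 = D i2 i0.
  by rewrite -hb -inner_normE /h /= !innerE ff gg (innerC f g) gf; ring.
have h12 : `|h i1 - h i2| ^+ 2 = D i1 i2.
  by rewrite -hc -inner_normE /h /= !innerE ff gg (innerC f g) gf; ring.
have hii k : `|h k - h k| ^+ 2 = D k k.
  by rewrite /D !subrr inner0l !normr0; ring.
have cases k : [\/ k = i0, k = i1 | k = i2].
  case: k => -[|[|[|//]]] kp; [constructor 1|constructor 2|constructor 3];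
  exact: val_inj.
have [->|->|->] := cases i; have [->|->|->] := cases j => //;
  by rewrite distrC DC.
Qed.

Lemma contraction_of_dim_le3 :
  (forall m, le_dim Y m -> (m <= 3)%N) -> convex_comb_contraction X v.
Proof.
move=> Y3 m m_gt0 Ym; have := Y3 m Ym.
case: m m_gt0 Ym => [//|[|[|[|//]]]] _ Ym _ x xs t Xx Xxs t0 t1.
- move: t1; rewrite !big_ord_recl !big_ord0 !addr0 => ->; rewrite !scale1r.
  exact: lipschitz_of_ball_extension.
- move: t1; rewrite !big_ord_recl !big_ord0 !addr0 => t1.
  have t1E : t (lift ord0 ord0) = 1 - t ord0 by rewrite -t1 addrC addKr.
  rewrite t1E; apply: two_point_contraction => //.
  by rewrite t0 -subr_ge0 -t1E t0.
- exact: three_point_contraction.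
Qed.

(** When [X] is convex, the two point inequality at a point of the segment
    makes [v] affine, and then a convex combination is just another point. *)
Lemma contraction_of_convex : convex_set X -> convex_comb_contraction X v.
Proof.
move=> /convex_setP cX m m_gt0 Ym x xs t Xx Xxs t0 t1.
have [m1|m1] := leqP m 1.
  have {}m1 : m = 1%N by apply/eqP; rewrite eqn_leq m1.
  move: xs t Xxs t0 t1; rewrite m1 => xs t Xxs t0.
  rewrite !big_ord_recl !big_ord0 !addr0 => ->; rewrite !scale1r.
  exact: lipschitz_of_ball_extension.
have Y2 : le_dim Y 2 by exact: le_dimW Ym m1.
have graph_convex : convex_set [set p : Z * Y | X p.1 /\ p.2 = v p.1].
  apply/convex_setP => -[z1 y1] [z2 y2] s s01 [/= X1 ->] [/= X2 ->].
  have X12 := cX _ _ _ s01 X1 X2; split => //=; apply/eqP.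
  have := two_point_contraction Y2 X12 X1 X2 s01.
  by rewrite subrr normr0 normr_le0 subr_eq0 eq_sym.
have := convex_sum (z := fun i => (xs i, v (xs i))) graph_convex t0 t1
  (fun i => conj (Xxs i) erefl).
have -> : \sum_i t i *: (xs i, v (xs i)) =
    (\sum_i t i *: xs i, \sum_i t i *: v (xs i)).
  by elim/big_rec3: _ => [//|i y1 y2 y3 _ ->].
move=> [/= Xs ->]; exact: lipschitz_of_ball_extension.
Qed.

End ExtensionToContraction.

Theorem theorem1p2 (R : realType) (Z Y : hilbertType R)
    (X : set Z) (v : Z -> Y) :
  (convex_comb_contraction X v -> convex_extension X v) /\
  (convex_extension X v -> ball_extension X v) /\
  (has_dim Y 1 \/ has_dim Y 2 \/ has_dim Y 3 \/ convex_set X ->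
   (ball_extension X v -> convex_comb_contraction X v) /\
   (convex_comb_contraction X v <-> convex_extension X v) /\
   (convex_extension X v <-> ball_extension X v)).
Proof.
have ci := @convex_extension_of_contraction R Z Y X v.
have cb := @ball_extension_of_convex_extension R Z Y X v.
split=> //; split=> // h.
have bc : ball_extension X v -> convex_comb_contraction X v.
  move=> ext; case: h => [Y1|[Y2|[Y3|cX]]].
  - by apply: (contraction_of_dim_le3 ext) => m /(_ _ Y1) /leq_trans; apply.
  - by apply: (contraction_of_dim_le3 ext) => m /(_ _ Y2) /leq_trans; apply.
  - by apply: (contraction_of_dim_le3 ext) => m /(_ _ Y3).
  - exact: contraction_of_convex.
split=> //; split; split; auto.
Qed.
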